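(* (i) Let $\Sigma$ be a finite $X$-symmetric graph of valency $\tilde b\ge 2$, let $l,s,\tilde r$ be integers with $l\ge s\ge 1$ and $\tilde b>\tilde r\ge 1$, and let $\Theta$ be a self-paired $(X,s)$-rank-transitive set of $(\tilde r,l)$-double-stars of $\Sigma$ such that $X_S\cap X_{C_\Sigma(T)}=X_T\cap X_{C_\Sigma(S)}$ for some $(S,T)\in\Theta$. Then there exists a finite $(X,s)$-arc-transitive graph $\Gamma$ admitting a nontrivial $X$-invariant partition $\mathcal{B}$ of $V(\Gamma)$ with $d=1$ and $r=\tilde r$ such that $\Gamma_{\mathcal{B}}\cong\Sigma$ but $\Gamma$ is not a multicover of $\Gamma_{\mathcal{B}}$. (ii) Conversely, let $s\ge 1$ be an integer and suppose $\Gamma$ is a finite $(X,s)$-arc-transitive graph admitting a nontrivial $X$-invariant partition $\mathcal{B}$ of $V(\Gamma)$ with $d=1$ such that $\Gamma$ is not a multicover of $\Gamma_{\mathcal{B}}$. Then there exist an integer $l\ge s$ and a self-paired $(X,s)$-rank-transitive set $\Theta$ of $(r,l)$-double-stars of $\Gamma_{\mathcal{B}}$ such that $X_S\cap X_{C_{\Gamma_{\mathcal{B}}}(T)}=X_T\cap X_{C_{\Gamma_{\mathcal{B}}}(S)}$ for any $(S,T)\in\Theta$. Here $(v,k,r,b,d)$ denotes the parameter quintuple $p(\Gamma,X,\mathcal{B})$.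
   Context: Graphs are finite, simple, undirected, with at least one edge. $X$ is a finite group. Transitive actions are understood to be on nonempty sets. Symmetric graphs. For $s\ge1$, an $s$-arc of a graph $\Gamma$ is a sequence of $s+1$ vertices in which any two consecutive terms are adjacent and any three consecutive terms are distinct; a 1-arc is called an arc; $Arc_s(\Gamma)$ is the set of $s$-arcs. Let $X$ act on $V(\Gamma)$ preserving adjacency and non-adjacency. $\Gamma$ is $(X,s)$-arc-transitive if $X$ is transitive on $V(\Gamma)$ and on $Arc_s(\Gamma)$; $X$-symmetric means $(X,1)$-arc-transitive. $\Gamma(\sigma)$ is the set of neighbours of $\sigma$. For an object $Y$ (vertex, or set of vertices or of arcs), $X_Y$ is its (set-wise) stabilizer in $X$. Partitions and quotients. A partition $\mathcal{B}$ of $V(\Gamma)$ is $X$-invariant if $B^x\in\mathcal{B}$ for all $B\in\mathcal{B}$, $x\in X$; it is nontrivial if some $B\in\mathcal{B}$ has $1<|B|<|V(\Gamma)|$. The quotient graph $\Gamma_{\mathcal{B}}$ has vertex set $\mathcal{B}$, two distinct blocks being adjacent iff there is at least one edge of $\Gamma$ between them; $X$ acts on it by permuting blocks. It is always assumed that $\Gamma_{\mathcal{B}}$ has at least one edge. For an $X$-symmetric graph $\Gamma$ and $X$-invariant partition $\mathcal{B}$, let $\Gamma_{\mathcal{B}}(\sigma)$ be the set of blocks containing at least one neighbour of the vertex $\sigma$, and let $\Gamma(B)$ be the set of vertices with at least one neighbour in $B$. For adjacent blocks $B,C$ put $v=|B|$, $k=|B\cap\Gamma(C)|$, $r=|\Gamma_{\mathcal{B}}(\sigma)|$,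 $b=$ the valency of $\Gamma_{\mathcal{B}}$, and $d=$ the valency of the bipartite subgraph of $\Gamma$ induced by $(B\cap\Gamma(C))\cup(C\cap\Gamma(B))$; these do not depend on choices and $p(\Gamma,X,\mathcal{B}):=(v,k,r,b,d)$. For $\mathcal{B}$ nontrivial, either $v=k\ge2$ and $r=b\ge 1$ ($\Gamma$ is a multicover of $\Gamma_{\mathcal{B}}$), or $v>k\ge1$ and $b>r\ge 1$ ($\Gamma$ is not a multicover of $\Gamma_{\mathcal{B}}$). Stars. Let $\Sigma$ be a finite $X$-symmetric graph of valency $\tilde b\ge1$ and $l\ge1$. For a set $S$ of $l$-arcs of $\Sigma$ and $1\le i\le l$, let $S(i)$ be the set of $i$-arcs $(\sigma,\sigma_1,\dots,\sigma_i)$ obtained by truncating the $l$-arcs $(\sigma,\sigma_1,\dots,\sigma_l)\in S$. For $1\le\tilde r\le\tilde b$, a set $S$ of $l$-arcs all starting at the same vertex $\sigma$ is an $(\tilde r,l)$-star if $|S(1)|=\tilde r$ and, for every $2\le i\le l$ and every $(\sigma,\sigma_1,\dots,\sigma_{i-1})\in S(i-1)$, there are exactly $\tilde r-1$ vertices $\sigma_i\in\Sigma(\sigma_{i-1})$ with $(\sigma,\sigma_1,\dots,\sigma_{i-1},\sigma_i)\in S(i)$. The vertex $\sigma$ is the center of $S$, denoted $C_\Sigma(S)$. Double-stars. Let $S,T$ be $(\tilde r,l)$-stars with centers $\sigma,\tau$. The pair $(S,T)$ is an $(\tilde r,l)$-double-star if $(\sigma,\tau)\in S(1)$, $(\tau,\sigma)\in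 T(1)$ and either $l=1$ or: (1) for every $(\sigma,\tau,\tau_1,\dots,\tau_{l-1})\in S$ one has $(\tau,\tau_1,\dots,\tau_{l-1})\in T(l-1)$; and (2) for every $(\tau,\sigma,\sigma_1,\dots,\sigma_{l-1})\in T$ one has $(\sigma,\sigma_1,\dots,\sigma_{l-1})\in S(l-1)$. Let $\Theta$ be a set of $(\tilde r,l)$-double-stars. It is self-paired if $(S,T)\in\Theta$ implies $(T,S)\in\Theta$. Put $V(\Theta)=\{S,T\mid(S,T)\in\Theta\}$. For $1\le s\le l$, $\Theta$ is $(X,s)$-rank-transitive if $X$ (in its induced action) is transitive on both $\Theta$ and $V(\Theta)$, and $X_S$ is transitive on $S(s)$ for every $S\in V(\Theta)$. *)

(* Defs.v *)
From HB Require Import structures.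
From mathcomp Require Import all_boot all_fingroup all_solvable.

Set Implicit Arguments.
Unset Strict Implicit.
Unset Printing Implicit Defensive.

Import GroupScope.

(* A finite simple undirected graph whose vertices are the members of [vset],
   a set in an ambient finite type; thus the quotient of a graph on [T] is a
   graph on [{set T}]. That a graph has at least one edge is [has_edge]; it
   also follows from transitivity on a set of s-arcs with s >= 1, since
   [transitive _, on A | _] entails that [A] is nonempty. *)
Record sgraph (T : finType) := SGraph {
  vset : {set T};
  adj : rel T;
  adj_vset : forall x y, adj x y -> (x \in vset) && (y \in vset);
  adj_sym : symmetric adj;
  adj_irr : irreflexive adj }.

Section Graphs.

Variable T : finType.
Implicit Types G : sgraph T.

Definition has_edge G := exists x y, adj G x y.

Definition nbrs G (x : T) : {set T} := [set y | adj G x y].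

Definition has_valency G (n : nat) := {in vset G, forall x, #|nbrs G x| = n}.

Definition arcs G (s : nat) : {set s.+1.-tuple T} :=
  [set p : s.+1.-tuple T | [&& all [in vset G] p, sorted (adj G) p &
    [forall x, forall y, forall z, infix [:: x; y; z] p ==> uniq [:: x; y; z]]]].

End Graphs.

Section Quotients.

Variable T : finType.
Implicit Types (G : sgraph T) (P : {set {set T}}).

Definition quot_adj G P : rel {set T} :=
  fun B C => [&& B \in P, C \in P, B != C &
                 [exists x in B, exists y in C, adj G x y]].

Lemma quot_adj_vset G P B C :
  quot_adj G P B C -> (B \in P) && (C \in P).
Proof. by case/and4P=> -> ->. Qed.

Lemma quot_adj_sym G P : symmetric (quot_adj G P).
Proof.
suff sub B C : quot_adj G P B C -> quot_adj G P C B.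
  by move=> B C; apply/idP/idP; apply: sub.
case/and4P=> PB PC neqBC /exists_inP[x Bx /exists_inP[y Cy xy]].
apply/and4P; split=> //; first by rewrite eq_sym.
by apply/exists_inP; exists y => //; apply/exists_inP; exists x; rewrite // adj_sym.
Qed.

Lemma quot_adj_irr G P : irreflexive (quot_adj G P).
Proof. by move=> B; rewrite /quot_adj eqxx !andbF. Qed.

Definition quotient_graph G P : sgraph {set T} :=
  SGraph (@quot_adj_vset G P) (@quot_adj_sym G P) (@quot_adj_irr G P).

Definition nbr_blocks G P (x : T) : {set {set T}} :=
  [set C in P | [exists y in C, adj G x y]].

Definition nbrs_of_set G (B : {set T}) : {set T} :=
  [set x in vset G | [exists y in B, adj G x y]].

Definition between G (B C : {set T}) : {set T} :=
  (B :&: nbrs_of_set G C) :|: (C :&: nbrs_of_set G B).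

(* [(v, k, r, b, d)] is the parameter quintuple of [G] and [P]; the five values
   are unique as soon as [quotient_graph G P] has an edge. *)
Record parameters G P (v k r b d : nat) : Prop := HasParameters {
  param_v : {in P, forall B : {set T}, #|B| = v};
  param_k : forall B C, adj (quotient_graph G P) B C ->
              #|B :&: nbrs_of_set G C| = k;
  param_r : {in vset G, forall x, #|nbr_blocks G P x| = r};
  param_b : has_valency (quotient_graph G P) b;
  param_d : forall B C, adj (quotient_graph G P) B C ->
              {in between G B C, forall x, #|nbrs G x :&: between G B C| = d} }.

Definition multicover_params (v k r b : nat) :=
  [/\ v = k, 2 <= k, r = b & 1 <= r].

End Quotients.

Section Stars.

Variable T : finType.
Implicit Types G : sgraph T.

(* The set of initial segments with [n] terms of the sequences in [S]: the
   i-arcs of S(i) have i + 1 vertices, so S(i) is [prefixes i.+1 S]. *)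
Definition prefixes n l (S : {set l.+1.-tuple T}) : {set n.-tuple T} :=
  [set u : n.-tuple T | [exists t in S, val u == take n t]].

(* [S] is an (r, l)-star with center [c]; the bound r <= valency is implied by
   #|S(1)| = r. The last condition is the one for S(i.+1), 2 <= i.+1 <= l. *)
Record is_star G (r l : nat) (c : T) (S : {set l.+1.-tuple T}) : Prop := IsStar {
  star_rank : 1 <= r;
  star_arcs : S \subset arcs G l;
  star_center : {in S, forall t : l.+1.-tuple T, thead t = c};
  star_first : #|prefixes 2 S| = r;
  star_next : forall i, 1 <= i < l -> {in prefixes i.+1 S, forall u,
    #|[set y in nbrs G (tnth u ord_max) | [tuple of rcons u y] \in prefixes i.+2 S]|
      = r.-1} }.

Definition is_double_star G (r l : nat) (S R : {set l.+1.-tuple T}) : Prop :=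
  exists c e, [/\ is_star G r c S, is_star G r e R,
    [tuple c; e] \in prefixes 2 S, [tuple e; c] \in prefixes 2 R &
    l = 1%N \/
    (forall u : l.-tuple T, [tuple of c :: u] \in S -> ohead u = Some e ->
       u \in prefixes l R) /\
    (forall u : l.-tuple T, [tuple of e :: u] \in R -> ohead u = Some c ->
       u \in prefixes l S)].

End Stars.

Definition graph_iso (T U : finType) (G : sgraph T) (H : sgraph U) : Prop :=
  exists f : T -> U,
    [/\ {in vset G &, injective f}, f @: vset G = vset H
      & {in vset G &, forall x y, adj H (f x) (f y) = adj G x y}].

Section PairAction.

Variables (X : finGroupType) (T : finType) (to : {action X &-> T}).

Definition pair_act (p : T * T) (x : X) : T * T := (to p.1 x, to p.2 x).

Lemma pair_act1 : pair_act^~ 1 =1 id.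
Proof. by case=> a b; rewrite /pair_act !act1. Qed.

Lemma pair_actM p : act_morph pair_act p.
Proof. by move=> x y; rewrite /pair_act !actM. Qed.

Definition pair_action : {action X &-> T * T} := TotalAction pair_act1 pair_actM.

End PairAction.

Section Actions.

Variables (X : finGroupType) (T : finType) (to : {action X &-> T}).
Implicit Types (G : sgraph T) (P : {set {set T}}).

(* (X, s)-arc-transitivity, where X = [set: X] acts by [to]. *)
Definition arc_transitive G (s : nat) : Prop :=
  [/\ {in vset G &, forall x y, forall a, adj G (to x a) (to y a) = adj G x y},
      [transitive [set: X], on vset G | to]
    & [transitive [set: X], on arcs G s | to * s.+1]].

Definition X_symmetric G := arc_transitive G 1.

(* [P] is a nontrivial X-invariant partition whose quotient has an edge. *)
Definition nontrivial_invariant_partition G P : Prop :=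
  [/\ partition P (vset G),
      [acts [set: X], on P | to^*],
      exists2 B, B \in P & 1 < #|B| < #|vset G|
    & has_edge (quotient_graph G P)].

Definition star_act l : {action X &-> {set l.+1.-tuple T}} :=
  ((to * l.+1)^*)%act.

Definition star_set l (Theta : {set {set l.+1.-tuple T} * {set l.+1.-tuple T}}) :
    {set {set l.+1.-tuple T}} :=
  [set p.1 | p in Theta] :|: [set p.2 | p in Theta].

Definition self_paired l
    (Theta : {set {set l.+1.-tuple T} * {set l.+1.-tuple T}}) : Prop :=
  forall S R, (S, R) \in Theta -> (R, S) \in Theta.

Definition rank_transitive (s l : nat)
    (Theta : {set {set l.+1.-tuple T} * {set l.+1.-tuple T}}) : Prop :=
  [/\ [transitive [set: X], on Theta | pair_action (star_act l)],
      [transitive [set: X], on star_set Theta | star_act l]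
    & {in star_set Theta, forall S : {set l.+1.-tuple T},
        [transitive 'N(S | to * l.+1), on prefixes s.+1 S | to * s.+1]}].

(* X_S :&: X_(center of R) = X_R :&: X_(center of S), for two stars S, R of G;
   their centers c, e are unique. *)
Definition balanced G (r l : nat) (S R : {set l.+1.-tuple T}) : Prop :=
  exists c e, [/\ is_star G r c S, is_star G r e R
    & 'N(S | to * l.+1) :&: 'C[e | to] = 'N(R | to * l.+1) :&: 'C[c | to]].

End Actions.

(* Main.v *)
Require Import Defs.
From HB Require Import structures.
From mathcomp Require Import all_boot all_fingroup all_solvable.
Import GroupScope.

(** Both directions concern a graph over another one by a morphism that is
injective on the neighbourhood of each vertex (an [immersion]): a star goes to
its centre, a vertex to its block. Under such a morphism non-backtracking walks
go to non-backtracking walks, and a walk has at most one lift with a given first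
vertex ([lift_uniq]).

From double-stars to a graph. Take the stars as vertices, the double-stars as
edges and the fibres of the centre as blocks. The stabilizer equality says that
an element which fixes S and the centre of R also fixes R; since X is transitive
on double-stars, a star S has at most one partner with a given centre
([dstar_uniq]), so d = 1. As X_S is transitive on S(1), the centres of the
partners of S are exactly the r ends of S(1) ([ctr_nbr]), so r < b forces the
blocks to be nontrivial and excludes multicovers. What remains is transitivity
on s-arcs. The point is that the i-arcs of the new graph that start at S lie over
the members of S(i), for i <= l. One half of the compatibility of S with a
partner R passes from S to R, and the two stars branch with the same number
r - 1, so compatibility also passes back from R to S ([dstar_back]). Hence the
centres of an arc from S form a member of S(i) ([arcseq_star]) and each member
lifts ([star_lift]). Transitivity of X on stars, of X_S on S(s) and uniqueness
of lifts give transitivity on s-arcs.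

From a graph to double-stars. For a vertex x let [block_star l x] be the set of
block sequences of l-arcs from x. With d = 1 the block map is an immersion and
these are stars, the stars of adjacent vertices form double-stars, and all the
transitivity statements are inherited from the graph. The stabilizer equality
is where l matters. Suppose that g fixes the star of x and the block of y. Then x
and its image x' have the same star, and y' (the image of y) is the neighbour of
x' in the block of y. A star of length l + 1 at x determines the star of length l
at each neighbour of x ([words_sub_nbr]), so y and y' have the same star of
length l as soon as equal stars of length l have equal prolongations to length
l + 1. For r > 1 the partition of vertices by equality of their stars gets finer
as l grows, so it is stable at some l >= s ([stable_length]), and this l is chosen;
for r = 1 there are no 2-arcs and l = s = 1. *)

Set Implicit Arguments.
Unset Strict Implicit.
Unset Printing Implicit Defensive.

(** * Arcs as sequences *)

Section ArcSequences.
Variables (T : finType) (G : sgraph T).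
Implicit Types (x y z : T) (p q : seq T).

(** Sequences rather than tuples, because arcs are shortened and prolonged at both
ends. *)
Fixpoint arcseq p : bool :=
  if p is x :: q then
    (x \in vset G) && (if q is y :: q' then
      [&& adj G x y, if q' is z :: _ then x != z else true & arcseq q] else true)
  else true.

Lemma adjL x y : adj G x y -> x \in vset G.
Proof. by case/adj_vset/andP. Qed.

Lemma adjR x y : adj G x y -> y \in vset G.
Proof. by case/adj_vset/andP. Qed.

Lemma adj_neq x y : adj G x y -> x != y.
Proof. by apply: contraTneq => ->; rewrite adj_irr. Qed.

Lemma arcseq_cons2 x y p : arcseq [:: x, y & p] =
  [&& x \in vset G, adj G x y, if p is z :: _ then x != z else true
    & arcseq (y :: p)].
Proof. by []. Qed.

Lemma arcseq1 x : arcseq [:: x] = (x \in vset G).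
Proof. by rewrite /= andbT. Qed.

Lemma arcseq2 x y : arcseq [:: x; y] = adj G x y.
Proof.
by rewrite /= andbT; case xy: (adj G x y); rewrite ?andbF // (adjL xy) (adjR xy).
Qed.

Lemma arcseq3 x y z p :
  arcseq [:: x, y, z & p] = [&& adj G x y, x != z & arcseq [:: y, z & p]].
Proof.
rewrite [LHS]/=; case xy: (adj G x y); rewrite ?andbF //=.
by rewrite (adjL xy).
Qed.

Lemma arcseq_tail x p : arcseq (x :: p) -> arcseq p.
Proof. by case: p => [|y p] //= /and4P[_ _ _]. Qed.

Lemma arcseq_adj x y p : arcseq [:: x, y & p] -> adj G x y.
Proof. by case: p => [|z p]; rewrite ?arcseq2 ?arcseq3 // => /andP[]. Qed.

Lemma arcseq_head x p : arcseq (x :: p) -> x \in vset G.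
Proof. by case/andP. Qed.

Lemma arcseq_all p x : arcseq p -> x \in p -> x \in vset G.
Proof.
elim: p => [|y p IH] // np; rewrite inE => /predU1P[->|]; first exact: arcseq_head np.
exact: IH (arcseq_tail np).
Qed.

Lemma arcsE s (p : s.+1.-tuple T) : (p \in arcs G s) = arcseq p.
Proof.
rewrite inE; elim: (val p) => [|x q IH].
  by apply/forallP => x; apply/forallP=> y; apply/forallP=> z; apply/implyP.
case: q IH => [|y q] IH.
  rewrite arcseq1; apply/and3P/idP => [[/andP[]] //|Vx]; split=> //.
    by rewrite /= Vx.
  apply/forallP => a; apply/forallP=> b; apply/forallP=> c; apply/implyP.
  by rewrite infixs1 => /orP[] /eqP.
rewrite arcseq_cons2 -IH; apply/and3P/and4P.
  case=> /andP[Vx Vp] /andP[xy sp] /forallP tri; split=> //.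
    case: q {IH Vp sp} tri => [//|z q] tri.
    have /forallP/(_ y)/forallP/(_ z)/implyP := tri x.
    rewrite infix_consl /= !eqxx prefix0s /= !inE negb_or => /(_ isT).
    by case/andP=> /andP[].
  apply/and3P; split=> //; apply/forallP=> a; apply/forallP=> b.
  apply/forallP=> c; apply/implyP => abc; have /forallP/(_ b)/forallP/(_ c) := tri a.
  by move/implyP; apply; rewrite infix_consl abc orbT.
case=> Vx xy xz /and3P[Vp sp /forallP tri].
split; [by rewrite /= Vx | by rewrite /= xy |].
apply/forallP=> a; apply/forallP=> b; apply/forallP=> c; apply/implyP.
rewrite infix_consl => /orP[|abc]; last first.
  by have /forallP/(_ b)/forallP/(_ c)/implyP := tri a; apply.
case: q xz {IH Vp tri} sp => [|z q] xz sp; rewrite /= ?andbF //.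
case/and4P=> /eqP-> /eqP-> /eqP-> _; rewrite !inE negb_or xz andbT (adj_neq xy).
by move: sp => /= /andP[yz _]; rewrite (adj_neq yz).
Qed.

(** An arc is prolonged by testing its last two vertices only; all the branching
numbers of stars are computed this way. *)
Lemma arcseq_rcons3 p x y z : arcseq (rcons (rcons (rcons p x) y) z) =
  [&& arcseq (rcons (rcons p x) y), adj G y z & x != z].
Proof.
have rcons0 u : rcons [::] u = [:: u] :> seq T by [].
elim: p => [|a p IH]; first by rewrite arcseq3 !arcseq2 [(x != z) && _]andbC.
case: p IH => [|b p] IH.
  by rewrite !rcons_cons !rcons0 !arcseq3 !arcseq2 [(x != z) && _]andbC !andbA.
by case: p IH => [|c p] IH;
  rewrite !(rcons_cons, rcons0) in IH *; rewrite arcseq3 IH (arcseq3 a) -!andbA.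
Qed.

Lemma arcseq_rcons p x y : arcseq (rcons (rcons p x) y) -> adj G x y.
Proof.
elim: p => [|a p IH]; first by move/arcseq_adj.
by move/arcseq_tail/IH.
Qed.

Lemma arcseq_cat p q : arcseq (p ++ q) -> arcseq p.
Proof.
elim: p => [|x p IH] //; case: p IH => [|y p] IH.
  by move/arcseq_head; rewrite arcseq1.
case: p IH => [|z p] IH; first by move/arcseq_adj; rewrite arcseq2.
by rewrite [_ ++ _]/= !arcseq3 => /and3P[-> -> /IH].
Qed.

Lemma arcseq_take n p : arcseq p -> arcseq (take n p).
Proof. by rewrite -{1}(cat_take_drop n p) => /arcseq_cat. Qed.

End ArcSequences.

(** * Locally injective graph morphisms *)

Section Immersion.
Variables (T U : finType) (G : sgraph T) (H : sgraph U) (f : T -> U).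

Definition immersion :=
  [/\ {in vset G, forall x, f x \in vset H},
      forall x y, adj G x y -> adj H (f x) (f y)
    & forall x y z, adj G x y -> adj G x z -> f y = f z -> y = z].

Hypothesis imf : immersion.

(** Two distinct neighbours of a vertex have distinct images, so no backtracking
appears in the image. *)
Lemma map_arcseq p : arcseq G p -> arcseq H (map f p).
Proof.
have [fV fadj finj] := imf.
elim: p => [|x p IH] //; case: p IH => [|y p] IH.
  by rewrite !arcseq1; apply: fV.
case: p IH => [|z p] IH; first by rewrite !arcseq2; apply: fadj.
rewrite !map_cons !arcseq3 => /and3P[xy xz yp]; rewrite fadj // IH // andbT.
apply: contra_neq xz => /(finj y); apply; first by rewrite adj_sym.
exact: arcseq_adj yp.
Qed.

Lemma lift_uniq x p q : arcseq G (x :: p) -> arcseq G (x :: q) ->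
  map f p = map f q -> p = q.
Proof.
have [fV fadj finj] := imf.
elim: p q x => [|y p IH] [|z q] x // px qx [yz pq].
have eyz : y = z.
  by apply: (finj x) => //; [apply: arcseq_adj px | apply: arcseq_adj qx].
rewrite -eyz in qx *; congr (_ :: _).
by apply: IH pq; [apply: arcseq_tail px | apply: arcseq_tail qx].
Qed.

End Immersion.

(** * Initial segments of a star *)

Section Prefixes.
Variables (T : finType).

(** The members of S(i), for all i at once: a sequence of i + 1 vertices with this
property. *)
Definition initial m (S : {set m.-tuple T}) (w : seq T) := [exists t in S, prefix w t].

Lemma initialP m (S : {set m.-tuple T}) w :
  reflect (exists2 t, t \in S & prefix w t) (initial S w).
Proof. exact: exists_inP. Qed.

Lemma mem_prefixes n l (S : {set l.+1.-tuple T}) (u : n.-tuple T) :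
  (u \in prefixes n S) = initial S u.
Proof. by rewrite inE; apply: eq_existsb => t; rewrite prefixE size_tuple eq_sym. Qed.

Variables (m : nat) (S : {set m.-tuple T}).

Lemma initial_size w : initial S w -> size w <= m.
Proof. by case/initialP=> t _ /size_prefix; rewrite size_tuple. Qed.

Lemma initial_cat w w' : initial S (w ++ w') -> initial S w.
Proof.
case/initialP=> t St wt; apply/initialP; exists t => //.
exact: catl_prefix wt.
Qed.

Lemma initial_rcons w x : initial S (rcons w x) -> initial S w.
Proof. by rewrite -cats1; apply: initial_cat. Qed.

Lemma initial_mem (t : m.-tuple T) : (t \in S) = initial S t.
Proof.
apply/idP/initialP => [St|[u Su]]; first by exists t; rewrite ?prefix_refl.
by rewrite prefixE size_tuple take_oversize ?size_tuple // => /eqP/val_inj <-.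
Qed.

Lemma initial_extend w n : initial S w -> size w <= n <= m ->
  exists w', initial S (w ++ w') /\ size (w ++ w') = n.
Proof.
case/initialP=> t St /prefixP[v tE] /andP[wn nm].
exists (take (n - size w) v); have takeE : w ++ take (n - size w) v = take n t.
  by rewrite tE take_cat ltnNge wn.
rewrite takeE size_takel ?size_tuple //; split=> //.
by apply/initialP; exists t; rewrite ?prefix_take.
Qed.

End Prefixes.

Section Star.
Variables (T : finType) (G : sgraph T) (r l : nat).

(** In terms of initial segments the branching condition speaks of vertices y that
prolong a sequence, whatever its length, with no tuples to cast. *)
Lemma is_starP (c : T) (S : {set l.+1.-tuple T}) : is_star G r c S <->
  [/\ 1 <= r, forall w, initial S w -> arcseq G w,
      forall x w, initial S (x :: w) -> x = c,
      #|[set y | initial S [:: c; y]]| = r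
    & forall w, 1 < size w <= l -> initial S w ->
        #|[set y | initial S (rcons w y)]| = r.-1].
Proof.
have cond1 : (forall x w, initial S (x :: w) -> x = c) ->
    #|prefixes 2 S| = #|[set y | initial S [:: c; y]]|.
  move=> hc; rewrite -(card_imset _ (_ : injective (fun y => [tuple c; y]))).
    congr #|pred_of_set _|; apply/setP=> u; rewrite mem_prefixes.
    apply/idP/imsetP=> [|[y]]; last by rewrite inE => cy ->.
    case/tupleP: u => x u; case/tupleP: u => y u; rewrite tuple0 => xy.
    have ex := hc _ _ xy; exists y; last by apply: val_inj; rewrite /= ex.
    by rewrite inE -ex.
  by move=> y z [].
have cond2 : (forall w, initial S w -> arcseq G w) -> forall i (u : i.+1.-tuple T) w z,
    val u = rcons w z ->
    [set y in nbrs G (tnth u ord_max) | [tuple of rcons u y] \in prefixes i.+2 S]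
      = [set y | initial S (rcons (rcons w z) y)].
  move=> hn i u w z uE; apply/setP=> y; rewrite [RHS]inE 2!inE mem_prefixes.
  have -> : tnth u ord_max = z.
    have iE : i = size w by have := congr1 size uE; rewrite size_tuple size_rcons => -[].
    by rewrite (tnth_nth z) /= uE iE nth_rcons ltnn eqxx.
  rewrite /= uE; case pz: (initial S _); rewrite ?andbF ?andbT //.
  exact: arcseq_rcons (hn _ pz).
split=> [[r1 sub ctr first next]|[r1 hn hc first next]].
  have hn w : initial S w -> arcseq G w.
    case/initialP=> t /(subsetP sub); rewrite arcsE => tn /prefixP[v tE].
    by rewrite tE in tn; apply: arcseq_cat tn.
  have hc x w : initial S (x :: w) -> x = c.
    by case/initialP=> t /ctr; case/tupleP: t => y t /=; rewrite theadE => -> /andP[/eqP].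
  split=> //; first by rewrite -cond1.
  move=> w; case/lastP: w => [|w z] // sw pz.
  have sz : size (rcons w z) == (size w).+1 by rewrite size_rcons.
  rewrite -(@cond2 hn _ (Tuple sz) w z) // next ?mem_prefixes //.
  by rewrite size_rcons ltnS in sw.
split=> //.
- by apply/subsetP=> t; rewrite initial_mem arcsE; apply: hn.
- by move=> t; rewrite initial_mem; case/tupleP: t => x t /hc; rewrite theadE.
- by rewrite cond1.
move=> i il u; rewrite mem_prefixes => pu.
have [w [z uE]] : exists w z, val u = rcons w z.
  have: size (val u) = i.+1 by apply: size_tuple.
  by case/lastP: (val u) => [|w z] // _; exists w, z.
have iE : i = size w by have := congr1 size uE; rewrite size_tuple size_rcons => -[].
by rewrite (@cond2 hn _ u w z) // next -?uE // size_tuple ltnS.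
Qed.

End Star.

(** * Group actions on arcs and stars *)

Section Actions.
Variables (X : finGroupType) (T : finType) (to : {action X &-> T}).

Lemma transitive_from (Y : finType) (toY : {action X &-> Y}) (A : {group X}) (D : {set Y}) x :
  x \in D -> (forall y, y \in D -> exists2 a, a \in A & y = toY x a) ->
  (forall a, a \in A -> toY x a \in D) -> [transitive A, on D | toY].
Proof.
move=> Dx ex st; apply/imsetP; exists x => //; apply/setP=> y.
apply/idP/imsetP=> [/ex|[a Aa ->]]; [by case=> a; exists a | exact: st].
Qed.

Lemma acts_stable (Y : finType) (toY : {action X &-> Y}) (D : {set Y}) :
  (forall y a, y \in D -> toY y a \in D) -> [acts [set: X], on D | toY].
Proof.
move=> st; apply/actsP=> a _ y; apply/idP/idP; last exact: st.
by move/(fun h => st _ a^-1 h); rewrite actK.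
Qed.

Lemma stabE l (S : {set l.+1.-tuple T}) a :
  (a \in 'N(S | to * l.+1)) = (star_act to l S a == S).
Proof. by rewrite -astab1_set; apply/astab1P/eqP. Qed.

Lemma star_actE l (S : {set l.+1.-tuple T}) a :
  star_act to l S a = [set n_act to t a | t in S].
Proof. by []. Qed.

Lemma initial_act l (S : {set l.+1.-tuple T}) a w :
  initial (star_act to l S a) (map (to^~ a) w) = initial S w.
Proof.
have im1 (R : {set l.+1.-tuple T}) b v :
    initial R v -> initial (star_act to l R b) (map (to^~ b) v).
  case/initialP=> t Rt vt; apply/initialP; exists (n_act to t b).
    by rewrite star_actE; apply: imset_f.
  by case/prefixP: vt => w' tE; rewrite /= tE map_cat prefix_prefix.
apply/idP/idP; last exact: im1.
move/(im1 _ a^-1); rewrite -actM mulgV act1 -map_comp (eq_map (g := id)) ?map_id //.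
by move=> x /=; rewrite actK.
Qed.

Variable G : sgraph T.

Definition preserves :=
  (forall x a, (to x a \in vset G) = (x \in vset G)) /\
  (forall x y a, adj G (to x a) (to y a) = adj G x y).

Lemma arc_transitive_preserves s : arc_transitive to G s -> preserves.
Proof.
case=> adjP tr _; have inV x a : (to x a \in vset G) = (x \in vset G).
  by apply: (acts_act (atrans_acts tr)); rewrite inE.
split=> // x y a; case xy: (adj G x y).
  by rewrite adjP // ?(adjL xy) ?(adjR xy).
apply/negP=> xay; have [Vx Vy] := (adjL xay, adjR xay).
by rewrite !inV in Vx Vy; rewrite adjP // xy in xay.
Qed.

Lemma arcseq_act p a : preserves -> arcseq G (map (to^~ a) p) = arcseq G p.
Proof.
case=> inV adjP; elim: p => [|x p IH] //; case: p IH => [|y p] IH.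
  by rewrite !arcseq1.
case: p IH => [|z p] IH; first by rewrite !arcseq2.
by rewrite !map_cons !arcseq3 adjP IH (inj_eq (act_inj to a)).
Qed.

Lemma linked_act B C a : preserves ->
  (to^*)%act (B :&: nbrs_of_set G C) a =
  (to^*)%act B a :&: nbrs_of_set G ((to^*)%act C a).
Proof.
case=> inV adjP; apply/setP=> x; rewrite -[x](actKV to a) [in RHS]inE.
have memE (D : {set T}) y : (to y a \in (to^*)%act D a) = (y \in D).
  exact: mem_imset (act_inj to a).
rewrite !memE; move: (to x a^-1) => {}x.
rewrite inE; congr (_ && _); rewrite !inE inV; congr (_ && _).
apply/exists_inP/exists_inP => [[y Cy xy] | [_ /imsetP[y Cy ->]]].
  by exists (to y a); rewrite ?memE ?adjP.
by rewrite adjP; exists y.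
Qed.

Lemma arc_transitiveP s : arc_transitive to G s <->
  [/\ preserves, [transitive [set: X], on vset G | to],
      exists2 p, size p = s.+1 & arcseq G p
    & forall p q, size p = s.+1 -> size q = s.+1 -> arcseq G p -> arcseq G q ->
        exists a, q = map (to^~ a) p].
Proof.
split=> [at_|[pr tr [p /eqP sp np] tra]].
  have pr := arc_transitive_preserves at_; have [_ tr tra] := at_.
  split=> //.
    have /imsetP[p + _] := tra; rewrite arcsE => np.
    by exists p; rewrite // size_tuple.
  move=> p q /eqP sp /eqP sq np nq.
  have := @atransP2 _ _ _ _ _ tra (Tuple sp) (Tuple sq).
  rewrite !arcsE => /(_ np nq)[a _ pq]; exists a.
  by have := congr1 val pq.
split=> //; first by case: pr => _ h x y _ _ a.
apply: (@transitive_from _ _ _ _ (Tuple sp)) => [|q|a _]; rewrite arcsE //.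
  move=> nq; have [] := tra p q => // [||a qE]; [exact/eqP | exact: size_tuple |].
  by exists a; rewrite ?inE //; apply: val_inj.
by rewrite /= arcseq_act.
Qed.

End Actions.

(** * The graph of double-stars *)

Section StarGraph.
Variables (X : finGroupType) (U : finType) (Sigma : sgraph U) (to : {action X &-> U}).
Variables (b l s r : nat) (Theta : {set {set l.+1.-tuple U} * {set l.+1.-tuple U}}).
(* The centre of the empty set of arcs, so that centres form a function. *)
Variable u0 : U.

Hypothesis sym : X_symmetric to Sigma.
Hypothesis valb : has_valency Sigma b.
Hypothesis s_range : 1 <= s <= l.
Hypothesis r_range : 1 <= r < b.
Hypothesis dstar : forall S R, (S, R) \in Theta -> is_double_star Sigma r S R.
Hypothesis paired : self_paired Theta.
Hypothesis rank : rank_transitive to s Theta.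
Hypothesis bal : exists S R, (S, R) \in Theta /\ balanced to Sigma r S R.

Local Notation star := {set l.+1.-tuple U}.
Local Notation sact := (star_act to l).
Implicit Types S R : star.

Definition ctr S : U := if [pick t in S] is Some t then thead t else u0.

Lemma ctr_star c S : is_star Sigma r c S -> ctr S = c.
Proof.
case/is_starP=> r1 _ hc first _; rewrite /ctr; case: pickP => [t | S0].
  by rewrite initial_mem; case/tupleP: t => x t /hc <-; rewrite theadE.
have /card_gt0P[y] : 0 < #|[set y | initial S [:: c; y]]| by rewrite first.
by rewrite inE => /initialP[t]; rewrite S0.
Qed.

Lemma star_setP S : reflect (exists R, (S, R) \in Theta) (S \in star_set Theta).
Proof.
apply: (iffP setUP) => [[]/imsetP[[S' R] SR ->] | [R SR]]; last first.
- by left; apply/imsetP; exists (S, R).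
- by exists S'; apply: paired.
by exists R.
Qed.

Lemma dstarP S R : (S, R) \in Theta ->
  [/\ is_star Sigma r (ctr S) S, is_star Sigma r (ctr R) R,
      initial S [:: ctr S; ctr R], initial R [:: ctr R; ctr S]
    & forall w, initial S [:: ctr S, ctr R & w] -> initial R (ctr R :: w)].
Proof.
case/dstar=> c [e [starS starR]]; rewrite !mem_prefixes => ce ec fwd.
rewrite (ctr_star starS) (ctr_star starR); split=> // w pw.
case: fwd => [l1 | [fwd _]].
  have : size [:: c, e & w] <= 2 by apply: leq_trans (initial_size pw) _; rewrite l1.
  by case: w {pw} => // _; apply: (@initial_cat _ _ R [:: e] [:: c]).
have [|w' [pw' sw']] := @initial_extend _ _ _ _ l.+1 pw.
  by rewrite (initial_size pw) /=.
have /eqP sz : size (e :: w ++ w') = l by case: sw'.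
have := fwd (Tuple sz); rewrite initial_mem mem_prefixes => /(_ pw' erefl).
exact: (@initial_cat _ _ R (e :: w)).
Qed.

Lemma starP S : S \in star_set Theta -> is_star Sigma r (ctr S) S.
Proof. by case/star_setP=> R /dstarP[]. Qed.

Lemma dstar_adj S R : (S, R) \in Theta -> adj Sigma (ctr S) (ctr R).
Proof.
by case/dstarP=> /is_starP[_ hn _ _ _] _ /hn; rewrite arcseq2.
Qed.

(** The double-star condition transports only the arcs of S through the centre of R
to R. Going back is a count: a common initial segment has r - 1 prolongations in
either star, and those of S are among those of R. At the centre of R itself, R
has r prolongations, of which one leads back to the centre of S and is excluded
in S by non-backtracking. *)
Lemma dstar_back S R w : (S, R) \in Theta -> size w < l -> initial R (ctr R :: w) ->
  (if w is f :: _ then f != ctr S else true) -> initial S [:: ctr S, ctr R & w].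
Proof.
move=> SR; have [/is_starP[_ nS _ fS xS] /is_starP[_ _ _ fR xR] SRp RSp fwd] := dstarP SR.
elim/last_ind: w => [|w y IH]; first by rewrite SRp.
rewrite size_rcons => sw pw fw.
have pw1 : initial S [:: ctr S, ctr R & w].
  apply: IH; [exact: ltnW | exact: (@initial_rcons _ _ R (ctr R :: w) y) |].
  by case: (w) fw.
have cS := xS [:: ctr S, ctr R & w] sw pw1.
pose A := [set z | initial S (rcons [:: ctr S, ctr R & w] z)].
pose B := [set z | initial R (rcons (ctr R :: w) z) && ((w == [::]) ==> (z != ctr S))].
have AB : A \subset B.
  apply/subsetP=> z; rewrite !inE => pz; rewrite (fwd (rcons w z)) //=.
  case: (w) pz => [|//] /= pz; have := nS _ pz; rewrite arcseq3 => /and3P[_ + _].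
  by rewrite eq_sym.
suff : y \in A by rewrite inE !rcons_cons.
suff -> : A = B.
  rewrite inE rcons_cons pw /=; case: (w) fw => [|//] /=; exact.
apply/eqP; rewrite eqEcard AB cS {AB}/B {cS A pw fw}.
case: w IH sw pw1 => [|f w] IH sw pw1 /=.
  have <- : #|[set z | initial R [:: ctr R; z]] :\ ctr S| = r.-1.
    by rewrite -fR [in RHS](cardsD1 (ctr S)) inE RSp.
  rewrite subset_leq_card //.
  by apply/subsetP=> z; rewrite !inE andbC.
rewrite -[_.-1](xR [:: ctr R, f & w]); first last.
- by apply: fwd.
- by rewrite /= in sw *; rewrite (ltnW sw).
by rewrite subset_leq_card //; apply/subsetP=> z; rewrite !inE andbT.
Qed.

Lemma star_set_act S a : (sact S a \in star_set Theta) = (S \in star_set Theta).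
Proof.
have [_ trV _] := rank.
by rewrite (acts_act (atrans_acts trV) (in_setT a)).
Qed.

Lemma ctr_act S a : S \in star_set Theta -> ctr (sact S a) = to (ctr S) a.
Proof.
move=> VS; have VSa : sact S a \in star_set Theta by rewrite star_set_act.
case/star_setP: VS => R /dstarP[_ _ + _ _]; rewrite -(initial_act to _ a).
by case/is_starP: (starP VSa) => _ _ hc _ _ /hc.
Qed.

Lemma Theta_act S R a : ((sact S a, sact R a) \in Theta) = ((S, R) \in Theta).
Proof.
have [trT _ _] := rank.
exact: (acts_act (atrans_acts trT) (in_setT a) (S, R)).
Qed.

(** If R and R' are partners of S with the same centre, some h fixes S and takes R to
R'. Such an h fixes the common centre, so it fixes R by the stabilizer equality,
which is known for one double-star and carried to (S, R) by conjugation. *)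
Lemma dstar_uniq S R R' : (S, R) \in Theta -> (S, R') \in Theta ->
  ctr R = ctr R' -> R = R'.
Proof.
move=> SR SR' eRR'; have [S0 [R0 [T0 [c [e [S0c R0e eqN]]]]]] := bal.
rewrite -(ctr_star S0c) -(ctr_star R0e) in eqN.
have VR0 : R0 \in star_set Theta by apply/star_setP; exists S0; apply: paired.
have [trT _ _] := rank.
have [g _ [/esym/= Sg /esym/= Rg]] := atransP2 trT T0 SR.
have [h _ [/esym/= Sh /esym/= Rh]] := atransP2 trT SR SR'.
have {}Sg : sact S0 g = S by []; have {}Rg : sact R0 g = R by [].
have {}Sh : sact S h = S by []; have {}Rh : sact R h = R' by [].
have VR : R \in star_set Theta by apply/star_setP; exists S; apply: paired.
(* Conjugation by g takes h back to the double-star with the known equality. *)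
have : g * h * g^-1 \in 'N(S0 | to * l.+1) :&: 'C[ctr R0 | to].
  rewrite inE stabE !actM Sg Sh -Sg actK eqxx /=.
  apply/astab1P; rewrite !actM -ctr_act // Rg -ctr_act // Rh -eRR' -Rg ctr_act //.
  by rewrite actK.
rewrite eqN inE stabE => /andP[/eqP fixR _].
by rewrite -Rh -Rg -{1}fixR -!actM mulgKV.
Qed.

(** X_S is transitive on S(s), hence on S(1), and some member of S(1) ends at the
centre of a partner of S. *)
Lemma ctr_nbr S y : S \in star_set Theta -> initial S [:: ctr S; y] ->
  exists2 R, (S, R) \in Theta & ctr R = y.
Proof.
move=> VS Sy; have /star_setP[R SR] := VS; have [_ _ SpR _ _] := dstarP SR.
have s2 : 1 < s.+1 <= l.+1 by rewrite !ltnS.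
have [w [pw /eqP sw]] := initial_extend Sy s2.
have [w' [pw' /eqP sw']] := initial_extend SpR s2.
have [_ _ trS] := rank.
have := @atransP2 _ _ _ _ _ (trS S VS) (Tuple sw') (Tuple sw).
rewrite !mem_prefixes => /(_ pw' pw)[a]; rewrite stabE => /eqP Sa /(congr1 val)[_ ey _].
exists (sact R a); first by rewrite -{1}Sa Theta_act.
by rewrite ctr_act //; apply/star_setP; exists S; apply: paired.
Qed.

Lemma dstar_adjV S R :
  (S, R) \in Theta -> (S \in star_set Theta) && (R \in star_set Theta).
Proof.
by move=> SR; apply/andP; split; apply/star_setP; [exists R | exists S; apply: paired].
Qed.

Lemma dstar_sym : symmetric (fun S R => (S, R) \in Theta).
Proof. by move=> S R; apply/idP/idP; apply: paired. Qed.

Lemma dstar_irr : irreflexive (fun S R => (S, R) \in Theta).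
Proof. by move=> S; apply/negP=> /dstar_adj; rewrite adj_irr. Qed.

Definition star_graph : sgraph {set l.+1.-tuple U} :=
  SGraph dstar_adjV dstar_sym dstar_irr.

Lemma ctr_immersion : immersion star_graph Sigma ctr.
Proof.
split; [|exact: dstar_adj | exact: dstar_uniq].
by move=> S /star_setP[R /dstar_adj/adjL].
Qed.

Lemma star_graph_preserves : preserves sact star_graph.
Proof. by split=> [S | S R] a; [apply: star_set_act | apply: Theta_act]. Qed.

(** By induction from the far end: the tail of an arc from S is an arc from its second
star R, so its centres form an initial segment of R, and [dstar_back] applies. It
does, since by [dstar_uniq] the third star has a centre other than that of S. *)
Lemma arcseq_star S p : size p <= l ->
  arcseq star_graph (S :: p) -> initial S (map ctr (S :: p)).
Proof.
elim: p S => [|R p IH] S sp np.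
  have /star_setP[R SR] := arcseq_head np.
  by have [_ _ + _ _] := dstarP SR; apply: (@initial_cat _ _ S [:: ctr S]).
have SR : (S, R) \in Theta := arcseq_adj np.
apply: (dstar_back SR); rewrite ?size_map //.
  by apply: IH (ltnW sp) _; apply: arcseq_tail np.
case: p np {IH sp} => [|S' p] //; rewrite arcseq3 => /and3P[_ SS' /arcseq_adj RS'].
apply: contra_neq SS' => eS.
by apply: dstar_uniq (esym eS); [apply: paired SR | apply: RS'].
Qed.

(** The forward half of the double-star condition keeps the rest of the sequence
inside the star reached at each step. *)
Lemma star_lift S w : S \in star_set Theta -> initial S (ctr S :: w) ->
  exists p, arcseq star_graph (S :: p) /\ map ctr p = w.
Proof.
elim: w S => [|y w IH] S VS pw; first by exists [::]; rewrite arcseq1.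
have [R SR eR] := ctr_nbr VS (@initial_cat _ _ S [:: ctr S; y] w pw).
have [/is_starP[_ nS _ _ _] _ _ _ fwd] := dstarP SR; rewrite -eR in pw *.
have [|p [np mp]] := IH R _ (fwd _ pw); first by case/andP: (dstar_adjV SR).
exists (R :: p); split; last by rewrite /= mp.
case: p np mp => [|S' p] np mp; first by rewrite arcseq2.
rewrite arcseq3 np andbT; apply/andP; split=> //.
have := nS _ pw; rewrite -mp /= => /and4P[_ _ + _].
by apply: contra_neq => ->.
Qed.

Lemma map_ctr_act p a : arcseq star_graph p ->
  map ctr (map (sact^~ a) p) = map (to^~ a) (map ctr p).
Proof.
move=> np; rewrite -!map_comp; apply/eq_in_map => S pS /=.
exact: ctr_act (arcseq_all np pS).
Qed.

Lemma star_set_inh : exists S R, (S, R) \in Theta.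
Proof. by have [S [R []]] := bal; exists S, R. Qed.

(** Bring the first vertices together by transitivity on stars, then the centres by
the stabilizer of the first star; unique lifting does the rest. *)
Lemma star_graph_arc_transitive : arc_transitive sact star_graph s.
Proof.
have [_ trV trS] := rank; have imc := ctr_immersion.
have sl : s <= l by case/andP: s_range.
apply/arc_transitiveP; split=> //; first exact: star_graph_preserves.
  have [S [R SR]] := star_set_inh; have [_ _ pSR _ _] := dstarP SR.
  have [|w [pw sw]] := @initial_extend _ _ _ _ s.+1 pSR; first by rewrite !ltnS.
  have [|p [np mp]] := star_lift _ pw; first by case/andP: (dstar_adjV SR).
  by exists (S :: p); rewrite // -sw -(size_map ctr) /= mp.
case=> [|S p] // [|R q] // sp sq np nq.
have [a _ RE] := atransP2 trV (arcseq_head np) (arcseq_head nq).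
have pr := star_graph_preserves.
have npa : arcseq star_graph (map (sact^~ a) (S :: p)) by rewrite arcseq_act.
have pRq : initial R (map ctr (R :: q)).
  by apply: arcseq_star; rewrite // -ltnS -[_.+1]/(size (R :: q)) sq.
have pRp : initial R (map ctr (map (sact^~ a) (S :: p))).
  rewrite RE; apply: (@arcseq_star (sact S a)) => //.
  by rewrite size_map -ltnS -[_.+1]/(size (S :: p)) sp.
have sRq : size (map ctr (R :: q)) == s.+1 by rewrite size_map sq.
have sRp : size (map ctr (map (sact^~ a) (S :: p))) == s.+1 by rewrite !size_map sp.
have := @atransP2 _ _ _ _ _ (trS R (arcseq_head nq)) (Tuple sRp) (Tuple sRq).
rewrite !mem_prefixes => /(_ pRp pRq)[h]; rewrite stabE => /eqP Rh /(congr1 val) eqh.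
exists (a * h).
have -> : map (sact^~ (a * h)) (S :: p) = map (sact^~ h) (map (sact^~ a) (S :: p)).
  by rewrite -map_comp; apply: eq_map => ? /=; rewrite actM.
have {}eqh : map ctr (R :: q) = map ctr (map (sact^~ h) (map (sact^~ a) (S :: p))).
  by rewrite map_ctr_act.
have nh := arcseq_act (map (sact^~ a) (S :: p)) h pr; rewrite npa in nh.
move: eqh nh; rewrite !map_cons -RE Rh => -[eqh] nh.
by congr (_ :: _); apply: (lift_uniq imc nq nh).
Qed.

Definition fib c := [set R in star_set Theta | c == ctr R].
Definition fibres := preim_partition ctr (star_set Theta).

Lemma mem_fib S c : (S \in fib c) = (S \in star_set Theta) && (c == ctr S).
Proof. by rewrite !inE. Qed.

Lemma ctr_vset S : S \in star_set Theta -> ctr S \in vset Sigma.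
Proof. by case: ctr_immersion => + _ _; apply. Qed.

Lemma ctr_onto c : c \in vset Sigma -> exists2 S, S \in star_set Theta & ctr S = c.
Proof.
move=> Vc; have [S [R SR]] := star_set_inh; have [_ trU _] := sym.
have /andP[VS _] := dstar_adjV SR.
have [a _ ->] := atransP2 trU (ctr_vset VS) Vc.
by exists (sact S a); rewrite ?star_set_act ?ctr_act.
Qed.

Lemma fibresP B : reflect (exists2 c, c \in vset Sigma & B = fib c) (B \in fibres).
Proof.
apply: (iffP imsetP) => [[S VS ->] | [c /ctr_onto[S VS <-] ->]]; last by exists S.
by exists (ctr S) => //; apply: ctr_vset.
Qed.

Lemma fib_inj : {in vset Sigma &, injective fib}.
Proof.
move=> c e /ctr_onto[S VS <-] _ eqf; have : S \in fib e by rewrite -eqf mem_fib VS /=.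
by rewrite mem_fib => /andP[_ /eqP].
Qed.

Lemma fib_act c a : (sact^*)%act (fib c) a = fib (to c a).
Proof.
apply/setP=> S; rewrite -{1}[S](actKV sact a) (mem_imset _ _ (act_inj sact a)) !mem_fib.
rewrite star_set_act; case VS: (S \in _) => //=.
by rewrite ctr_act // -[c == _](inj_eq (act_inj to a)) /= actKV.
Qed.

Lemma base_adj_move c e c' e' : adj Sigma c e -> adj Sigma c' e' ->
  exists a, to c a = c' /\ to e a = e'.
Proof.
move: sym => /arc_transitiveP[_ _ _ tr]; rewrite -!arcseq2 => ce ce'.
by have [a [-> ->]] := tr [:: c; e] [:: c'; e'] erefl erefl ce ce'; exists a.
Qed.

Lemma fib_adj c e : c \in vset Sigma -> e \in vset Sigma ->
  adj (quotient_graph star_graph fibres) (fib c) (fib e) = adj Sigma c e.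
Proof.
move=> Vc Ve; apply/and4P/idP => [[_ _ _ /exists_inP[S Sc /exists_inP[R Re SR]]] | ce].
  rewrite mem_fib in Sc; rewrite mem_fib in Re.
  by case/andP: Sc => _ /eqP->; case/andP: Re => _ /eqP->; apply: dstar_adj.
split; [by apply/fibresP; exists c | by apply/fibresP; exists e | |].
  by apply: contraTneq ce => /fib_inj-> //; rewrite adj_irr.
have [S [R SR]] := star_set_inh; have /andP[VS VR] := dstar_adjV SR.
have [a [<- <-]] := base_adj_move (dstar_adj SR) ce.
apply/exists_inP; exists (sact S a); first by rewrite mem_fib star_set_act VS ctr_act /=.
apply/exists_inP; exists (sact R a); first by rewrite mem_fib star_set_act VR ctr_act /=.
by rewrite /= Theta_act.
Qed.

(** Blocks next to S correspond to S(1); this gives the parameter r. *)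
Lemma fibre_nbrs S : S \in star_set Theta ->
  nbr_blocks star_graph fibres S = fib @: [set y | initial S [:: ctr S; y]].
Proof.
move=> VS; apply/setP=> C; rewrite inE; apply/andP/imsetP.
  case=> /fibresP[e Ve ->] /exists_inP[R]; rewrite mem_fib => /andP[_ /eqP->] /= SR.
  by exists (ctr R) => //; rewrite inE; case/dstarP: SR.
case=> y; rewrite inE => /(ctr_nbr VS)[R SR <-] ->.
have /andP[_ VR] := dstar_adjV SR.
split; first by apply/fibresP; exists (ctr R) => //; apply: ctr_vset.
by apply/exists_inP; exists R => //; rewrite mem_fib VR /=.
Qed.

Lemma card_nbr_blocks S : S \in star_set Theta -> #|nbr_blocks star_graph fibres S| = r.
Proof.
move=> VS; rewrite fibre_nbrs //; have /is_starP[_ nS _ fS _] := starP VS.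
rewrite card_in_imset ?fS // => x y; rewrite !inE => /nS + /nS; rewrite !arcseq2.
by move=> /adjR Vx /adjR Vy; apply: fib_inj.
Qed.

Lemma fibre_valency : has_valency (quotient_graph star_graph fibres) b.
Proof.
move=> B /fibresP[c Vc ->]; rewrite -(valb Vc).
rewrite -(card_in_imset (f := fib) (D := mem (nbrs Sigma c))); last first.
  by move=> x y; rewrite !inE => /adjR Vx /adjR Vy; apply: fib_inj.
congr #|pred_of_set _|; apply/setP=> C; rewrite inE; apply/idP/imsetP.
  move=> cC; have /fibresP[e Ve eC] := adjR cC.
  by exists e; rewrite // inE -fib_adj // -eC.
by case=> e; rewrite inE => ce ->; rewrite fib_adj // (adjR ce).
Qed.

Lemma linkedP S c e :
  reflect (ctr S = c /\ exists2 R, (S, R) \in Theta & ctr R = e)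
    (S \in fib c :&: nbrs_of_set star_graph (fib e)).
Proof.
have inN : (S \in nbrs_of_set star_graph (fib e)) =
    (S \in star_set Theta) && [exists R in fib e, (S, R) \in Theta].
  by rewrite inE.
rewrite in_setI mem_fib inN; apply: (iffP and3P).
  case=> /andP[_ /eqP->] _ /exists_inP[R]; rewrite mem_fib => /andP[_ /eqP->] SR.
  by split=> //; exists R.
case=> <- [R SR <-]; have /andP[VS VR] := dstar_adjV SR; rewrite VS eqxx.
by split=> //; apply/exists_inP; exists R; rewrite // mem_fib VR /=.
Qed.

Lemma fibre_parameters : exists v k, parameters star_graph fibres v k r b 1.
Proof.
have [S [R SR]] := star_set_inh; have /andP[VS VR] := dstar_adjV SR.
have pr := star_graph_preserves.
exists #|fib (ctr S)|, #|fib (ctr S) :&: nbrs_of_set star_graph (fib (ctr R))|.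
have adjP B C : adj (quotient_graph star_graph fibres) B C ->
    exists c e, [/\ B = fib c, C = fib e & adj Sigma c e].
  move=> BC; have /fibresP[c Vc eB] := adjL BC; have /fibresP[e Ve eC] := adjR BC.
  by exists c, e; rewrite -fib_adj // -eB -eC.
split; [| | exact: card_nbr_blocks | exact: fibre_valency |].
- move=> B /fibresP[c Vc ->]; have [_ trU _] := sym.
  have [a _ ->] := atransP2 trU (ctr_vset VS) Vc.
  by rewrite -fib_act card_setact.
- move=> _ _ /adjP[c [e [-> -> ce]]].
  have [a [<- <-]] := base_adj_move (dstar_adj SR) ce.
  by rewrite -!fib_act -linked_act // card_setact.
move=> _ _ /adjP[c [e [-> -> ce]]].
have one c1 e1 : adj Sigma c1 e1 ->
    forall Q, Q \in fib c1 :&: nbrs_of_set star_graph (fib e1) ->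
    #|nbrs star_graph Q :&: between star_graph (fib c1) (fib e1)| = 1%N.
  move=> ce1 Q /linkedP[eQ [Q' QQ' eQ']]; apply/eqP/cards1P; exists Q'.
  apply/setP=> Q2; rewrite in_setI in_set1 [Q2 \in nbrs _ _]inE.
  apply/andP/eqP => [[QQ2] | ->].
    case/setUP=> /linkedP[eQ2 _].
      by have := dstar_adj QQ2; rewrite eQ2 eQ adj_irr.
    by apply: dstar_uniq QQ2 QQ' _; rewrite eQ'.
  split=> //; apply/setUP; right; apply/linkedP; split=> //.
  by exists Q => //; apply: paired.
move=> Q /setUP[]; first exact: one.
by rewrite /between setUC; apply: one; rewrite adj_sym.
Qed.

(** A block with a single star S would have all its b neighbouring blocks next to S,
against r < b. *)
Lemma star_graph_partition :
  nontrivial_invariant_partition sact star_graph fibres.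
Proof.
have [S [R SR]] := star_set_inh; have /andP[VS VR] := dstar_adjV SR.
have Vc := ctr_vset VS; have Ve := ctr_vset VR.
have cP c : c \in vset Sigma -> fib c \in fibres by move=> ?; apply/fibresP; exists c.
have [rb r1] : r < b /\ 0 < r by case/andP: r_range.
split; first exact: preim_partitionP.
- apply: acts_stable => _ a /fibresP[c cV ->].
  rewrite fib_act; apply: cP; have [_ trU _] := sym.
  by rewrite (acts_act (atrans_acts trU) (in_setT a)).
- exists (fib (ctr S)); first exact: cP.
  apply/andP; split; last first.
    apply: proper_card; rewrite properE; apply/andP; split.
      by apply/subsetP=> Q; rewrite inE => /andP[].
    apply/subsetPn; exists R => //; rewrite mem_fib VR /=.
    by rewrite (adj_neq (dstar_adj SR)).
  rewrite ltnNge; apply/negP=> /card_le1_eqP le1.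
  suff : b <= r by rewrite leqNgt rb.
  rewrite -(fibre_valency (cP _ Vc)) -(card_nbr_blocks VS) subset_leq_card //.
  apply/subsetP=> C; rewrite inE => SC; have CP := adjR SC.
  have /and4P[_ _ _ /exists_inP[Q Qc QC]] := SC.
  have Sc : S \in fib (ctr S) by rewrite mem_fib VS /=.
  by rewrite inE CP (le1 _ _ Qc Sc).
by exists (fib (ctr S)), (fib (ctr R)); rewrite fib_adj //; apply: dstar_adj.
Qed.

Lemma quotient_iso : graph_iso (quotient_graph star_graph fibres) Sigma.
Proof.
pose f (B : {set star}) := if [pick R in B] is Some R then ctr R else u0.
have fE c : c \in vset Sigma -> f (fib c) = c.
  case/ctr_onto=> S VS <-; rewrite /f; case: pickP => [R | /(_ S)].
    by rewrite mem_fib => /andP[_ /eqP].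
  by rewrite mem_fib VS eqxx.
exists f; split.
- by move=> _ _ /fibresP[c Vc ->] /fibresP[e Ve ->]; rewrite !fE // => ->.
- apply/setP=> c; apply/imsetP/idP => [[_ /fibresP[e Ve ->] ->] | Vc].
    by rewrite fE.
  by exists (fib c); rewrite ?fE //; apply/fibresP; exists c.
by move=> _ _ /fibresP[c Vc ->] /fibresP[e Ve ->]; rewrite !fE // fib_adj.
Qed.

End StarGraph.

(** * Stars of blocks around a vertex *)

Section BlockStars.
Variables (X : finGroupType) (s : nat) (T : finType) (G : sgraph T).
Variables (to : {action X &-> T}) (P : {set {set T}}) (v k r b : nat).
Hypothesis s_gt0 : 1 <= s.
Hypothesis tr : arc_transitive to G s.
Hypothesis inv : nontrivial_invariant_partition to G P.
Hypothesis par : parameters G P v k r b 1.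

Local Notation Q := (quotient_graph G P).
Local Notation pi := (pblock P).

Let coverP : cover P = vset G.
Proof. by case: inv => /and3P[/eqP]. Qed.

Let trivP : trivIset P.
Proof. by case: inv => /and3P[]. Qed.

Let presG : preserves to G := arc_transitive_preserves tr.

Lemma pi_vset x : x \in vset G -> pi x \in P.
Proof. by rewrite -coverP; apply: pblock_mem. Qed.

Lemma pi_mem x : x \in vset G -> x \in pi x.
Proof. by rewrite mem_pblock coverP. Qed.

Lemma pi_block C y : C \in P -> y \in C -> pi y = C.
Proof. exact: def_pblock. Qed.

Lemma pi_act x a : x \in vset G -> pi (to x a) = (to^*)%act (pi x) a.
Proof.
move=> Vx; apply: pi_block; last by apply: mem_setact; apply: pi_mem.
by case: inv => _ actP _ _; rewrite (acts_act actP (in_setT a)) pi_vset.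
Qed.

Lemma nbr_blocksP x C :
  reflect (exists2 y, adj G x y & pi y = C) (C \in nbr_blocks G P x).
Proof.
rewrite inE; apply: (iffP andP) => [[PC /exists_inP[y Cy xy]] | [y xy <-]].
  by exists y; rewrite ?(pi_block PC).
split; first exact: pi_vset (adjR xy).
by apply/exists_inP; exists y => //; apply: pi_mem (adjR xy).
Qed.

Lemma nbr_blocks_card x : x \in vset G -> #|nbr_blocks G P x| = r.
Proof. by case: par => _ _ + _ _; apply. Qed.

Lemma quot_adjE x y : adj G x y -> pi x != pi y -> adj Q (pi x) (pi y).
Proof.
move=> xy neq; have [Vx Vy] := (adjL xy, adjR xy).
apply/and4P; split; rewrite ?pi_vset //.
apply/exists_inP; exists x; first exact: pi_mem.
by apply/exists_inP; exists y; first exact: pi_mem.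
Qed.

Lemma pi_uniq_across x y z : adj G x y -> adj G x z -> pi x != pi y ->
  pi y = pi z -> y = z.
Proof.
move=> xy xz neq eyz; have [_ _ _ _ d1] := par.
have Vx := adjL xy; have Vy := adjR xy; have Vz := adjR xz.
have xB : x \in between G (pi x) (pi y).
  apply/setUP; left; rewrite !inE pi_mem // Vx.
  by apply/exists_inP; exists y; rewrite ?pi_mem.
have outB u : adj G x u -> pi u = pi y -> u \in between G (pi x) (pi y).
  move=> xu eu; apply/setUP; right; rewrite !inE -eu pi_mem ?(adjR xu) //=.
  by apply/exists_inP; exists x; rewrite ?pi_mem // adj_sym.
have /eqP/cards1P[w wE] := d1 _ _ (quot_adjE xy neq) _ xB.
have inw u : adj G x u -> pi u = pi y -> u = w.
  by move=> xu eu; apply/set1P; rewrite -wE !inE xu; have := outB _ xu eu; rewrite !inE.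
by rewrite (inw y xy erefl) (inw z xz (esym eyz)).
Qed.

Lemma quot_edge : exists x y, adj G x y /\ pi x != pi y.
Proof.
have [_ _ _ [B [C /and4P[PB PC neq /exists_inP[x Bx /exists_inP[y Cy xy]]]]]] := inv.
by exists x, y; rewrite (pi_block PB Bx) (pi_block PC Cy).
Qed.

Lemma r_gt0 : 0 < r.
Proof.
have [x [y [xy _]]] := quot_edge; rewrite -(nbr_blocks_card (adjL xy)).
by apply/card_gt0P; exists (pi y); apply/nbr_blocksP; exists y.
Qed.

(** If r = 1 then a vertex x with a neighbour in another block has all its neighbours
in that block, hence just one because d = 1. By transitivity on vertices there is
no 2-arc at all, and s = 1. *)
Lemma short_or_branching : s <= 1 \/ 1 < r.
Proof.
have /arc_transitiveP[_ trV [p sp np] _] := tr.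
case: (ltnP 1 r) => [|r1]; [by right | left].
rewrite leqNgt; apply/negP=> s2.
have : 2 < size p by rewrite sp.
case: p np {sp} => [|w [|y [|z p]]] // + _; rewrite arcseq3 => /and3P[wy wz /arcseq_adj yz].
have [x0 [y0 [xy0 neq0]]] := quot_edge; have [_ adjP] := presG.
have [a _ xE] := atransP2 trV (adjR wy) (adjL xy0).
have wa : adj G x0 (to w a) by rewrite xE adjP adj_sym.
have za : adj G x0 (to z a) by rewrite xE adjP.
have le1 : #|nbr_blocks G P x0| <= 1 by rewrite nbr_blocks_card // (adjL xy0).
have same u : adj G x0 u -> pi y0 = pi u.
  move=> xu; apply: (card_le1_eqP le1); apply/nbr_blocksP; [by exists u | by exists y0].
case/eqP: wz; apply: (act_inj to a); apply: (pi_uniq_across wa za).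
  by rewrite -(same _ wa).
by rewrite -(same _ wa) (same _ za).
Qed.

(** A vertex with at least two neighbouring blocks has a neighbour outside the block of
its predecessor. *)
Lemma arcseq_extend n x p : arcseq G (x :: p) -> size p <= n -> n <= 1 \/ 1 < r ->
  exists p', arcseq G (x :: p ++ p') /\ size (p ++ p') = n.
Proof.
move=> np sp nr.
have [m mE] : exists m, n = size p + m by exists (n - size p); rewrite subnKC.
elim: m p np {sp} mE => [|m IH] p np mE.
  by exists [::]; rewrite cats0 mE addn0.
suff [y npy] : exists y, arcseq G (x :: rcons p y).
  have [|p' [np' sp']] := IH _ npy; first by rewrite size_rcons addSnnS.
  by exists (y :: p'); rewrite -cat_rcons.
case: (lastP p) np mE => [|p' z] np mE.
  have Vx := arcseq_head np; have := r_gt0; rewrite -(nbr_blocks_card Vx).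
  by case/card_gt0P=> C /nbr_blocksP[y xy _]; exists y; rewrite arcseq2.
have r1 : 1 < r by case: nr => //; rewrite mE size_rcons addnS addSn.
have [q [u eq]] : exists q u, x :: p' = rcons q u.
  by exists (belast x p'), (last x p'); rewrite -lastI.
have npE y : arcseq G (x :: rcons (rcons p' z) y) = adj G z y && (u != y).
  by rewrite -!rcons_cons eq arcseq_rcons3 -eq rcons_cons np.
have Vz : z \in vset G by apply: arcseq_all np _; rewrite !inE mem_rcons mem_head orbT.
have : 0 < #|nbr_blocks G P z :\ pi u|.
  have := nbr_blocks_card Vz; rewrite (cardsD1 (pi u)) => rE; rewrite -rE in r1.
  by case: (_ \in _) r1; rewrite ?add0n ?add1n // => /ltnW.
case/card_gt0P=> C /setD1P[Cu /nbr_blocksP[y zy yC]]; exists y.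
by rewrite npE zy; apply: contraNneq Cu => ->; rewrite yC.
Qed.

(** Any two arcs prolong to s-arcs, and these are in one orbit. *)
Lemma adj_move x y x' y' : adj G x y -> adj G x' y' ->
  exists a, to x a = x' /\ to y a = y'.
Proof.
rewrite -!arcseq2 => xy xy'; have /arc_transitiveP[_ _ _ trA] := tr.
have [p [np sp]] := arcseq_extend xy s_gt0 short_or_branching.
have [p' [np' sp']] := arcseq_extend xy' s_gt0 short_or_branching.
have [a [-> -> _]] := trA [:: x, y & p] [:: x', y' & p']
  (congr1 S sp) (congr1 S sp') np np'.
by exists a.
Qed.

(** X moves any edge to an edge between distinct blocks. *)
Lemma pi_adj_neq x y : adj G x y -> pi x != pi y.
Proof.
have [x0 [y0 [xy0 neq0]]] := quot_edge; case/(adj_move xy0) => a [<- <-].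
by rewrite !pi_act ?(adjL xy0) ?(adjR xy0) // (inj_eq (act_inj _ a)).
Qed.

Lemma pi_immersion : immersion G Q pi.
Proof.
split=> [x | x y xy | x y z xy xz]; first exact: pi_vset.
  exact: quot_adjE (pi_adj_neq xy).
exact: pi_uniq_across (pi_adj_neq xy).
Qed.

(** The first vertex is left out of w, since its block is known. *)
Definition lifts x w := exists2 p, arcseq G (x :: p) & map pi p = w.

Definition block_star l x : {set l.+1.-tuple {set T}} :=
  [set map_tuple pi p | p in arcs G l & thead p == x].

Lemma block_starP l x (t : l.+1.-tuple {set T}) :
  t \in block_star l x <-> exists2 p, arcseq G (x :: p) & t = map pi (x :: p) :> seq _.
Proof.
split=> [/imsetP[p + ->] | [p np tE]].
  rewrite inE; case/tupleP: p => y p; rewrite arcsE theadE => /andP[np /eqP yx].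
  by rewrite yx in np *; exists p.
have /eqP sp : size (x :: p) = l.+1 by rewrite -(size_map pi) -tE size_tuple.
apply/imsetP; exists (Tuple sp); last exact: val_inj.
by rewrite inE arcsE np /=; apply/eqP.
Qed.

Section Length.
Variable l : nat.
Hypothesis lr : l <= 1 \/ 1 < r.

Lemma initial_block_star x C w :
  initial (block_star l x) (C :: w) <-> [/\ C = pi x, size w <= l & lifts x w].
Proof.
split=> [/initialP[t /block_starP[p np tE] /prefixP[w' tE']] | [-> sw [p np pw]]].
  move: (size_tuple t) tE; rewrite tE' => st [-> pE]; split=> //.
    by move: st => [<-]; rewrite size_cat leq_addr.
  exists (take (size w) p); first exact: (arcseq_take (size w).+1 np).
  by rewrite map_take -pE take_size_cat.
have [|p' [np' sp']] := arcseq_extend np _ lr; first by rewrite -(size_map pi) pw.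
have /eqP sz : size (map pi (x :: p ++ p')) = l.+1 by rewrite /= size_map sp'.
apply/initialP; exists (Tuple sz); first by apply/block_starP; exists (p ++ p').
by rewrite /= eqxx map_cat pw prefix_prefix.
Qed.

(** The prolongations of a lifted sequence that ends at z after u correspond to the r
blocks next to z other than the block of u. *)
Lemma is_star_block_star x : 0 < l -> x \in vset G -> is_star Q r (pi x) (block_star l x).
Proof.
move=> l1 Vx; have imf := pi_immersion; apply/is_starP; split.
- exact: r_gt0.
- by case=> // C w /initial_block_star[-> _ [p np <-]]; apply: (map_arcseq imf np).
- by move=> C w /initial_block_star[].
- rewrite -(nbr_blocks_card Vx); congr #|pred_of_set _|; apply/setP=> C.
  rewrite inE; apply/idP/nbr_blocksP => [/initial_block_star[_ _ [p np]] | [y xy yC]].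
    by case: p np => [|y [|z p]] // /arcseq_adj xy [yC]; exists y.
  by apply/initial_block_star; split=> //; exists [:: y]; rewrite ?arcseq2 //= yC.
case=> // C w sw /initial_block_star[-> _ [p np pw]].
have [q [u [z eq]]] : exists q u z, x :: p = rcons (rcons q u) z.
  case: (lastP p) pw => [pw|p' z _]; first by rewrite -pw in sw.
  by exists (belast x p'), (last x p'), z; rewrite -lastI rcons_cons.
have nq := np; rewrite eq in nq; have uz := arcseq_rcons nq.
have npE y : arcseq G (x :: rcons p y) = adj G z y && (u != y).
  by rewrite -rcons_cons eq arcseq_rcons3 nq.
rewrite -(nbr_blocks_card (adjR uz)) [in RHS](cardsD1 (pi u)).
have -> : pi u \in nbr_blocks G P z by apply/nbr_blocksP; exists u; rewrite // adj_sym.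
rewrite add1n /=; congr #|pred_of_set _|; apply/setP=> D; rewrite inE in_setD1.
apply/idP/andP => [/initial_block_star[_ _ [p' np' p'E]] | [Du /nbr_blocksP[y zy yD]]].
  have [p1 [y p'y]] : exists p1 y, p' = rcons p1 y.
    by case/lastP: p' p'E {np'} => [|p1 y] p'E; [case: (w) p'E | exists p1, y].
  rewrite p'y in np' p'E; rewrite map_rcons in p'E; case/rcons_inj: p'E => p1w yD.
  have p1p : p1 = p.
    rewrite -cats1 -cat_cons in np'.
    by apply: (lift_uniq imf (arcseq_cat np') np); rewrite p1w.
  rewrite p1p npE in np'; case/andP: np' => zy uy.
  split; last by apply/nbr_blocksP; exists y.
  rewrite -yD; apply: contra_neq uy => yu; have [_ _ uniq] := imf.
  by apply/esym/(uniq z); rewrite // adj_sym.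
apply/initial_block_star; split=> //; first by rewrite size_rcons; case/andP: sw.
exists (rcons p y); last by rewrite map_rcons pw yD.
by rewrite npE zy; apply: contraNneq Du => ->; rewrite yD.
Qed.

Lemma lifts_cons x y w : adj G x y -> lifts x (pi y :: w) -> lifts y w.
Proof.
have [_ _ uniq] := pi_immersion.
move=> xy [[|z p] // np [zy <-]].
have zy' : z = y by apply: uniq zy; [apply: arcseq_adj np|].
by rewrite zy' in np; exists p => //; apply: arcseq_tail np.
Qed.

Lemma block_star_double x y : 0 < l -> adj G x y ->
  is_double_star Q r (block_star l x) (block_star l y).
Proof.
move=> l1 xy; have yx : adj G y x by rewrite adj_sym.
exists (pi x), (pi y).
have two u w : adj G u w -> initial (block_star l u) [:: pi u; pi w].
  by move=> uw; apply/initial_block_star; split=> //; exists [:: w]; rewrite ?arcseq2.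
split; rewrite ?mem_prefixes /=; try exact: two.
- exact: is_star_block_star (adjL xy).
- exact: is_star_block_star (adjR xy).
right.
have half x' y' (u : l.-tuple {set T}) : adj G x' y' ->
    [tuple of pi x' :: u] \in block_star l x' -> ohead u = Some (pi y') ->
    u \in prefixes l (block_star l y').
  move=> xy'; rewrite initial_mem mem_prefixes /= => /initial_block_star[_ su lu].
  case: (val u) su lu => [|C w] //= sw lu [CE]; rewrite CE in lu *.
  by apply/initial_block_star; split; [| exact: ltnW | exact: lifts_cons lu].
by split=> u; apply: half.
Qed.

End Length.

Lemma block_star_act l x a :
  block_star l (to x a) = star_act (to^*)%act l (block_star l x) a.
Proof.
have sub y c t : t \in block_star l y ->
    n_act (to^*) t c \in block_star l (to y c).
  case/block_starP=> p np tE; apply/block_starP.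
  exists (map (to^~ c) p); first by rewrite -(arcseq_act (y :: p) c presG) in np.
  rewrite [LHS]/= tE -[to y c :: _]/(map (to^~ c) (y :: p)) -!map_comp.
  apply/eq_in_map=> z pz /=.
  by rewrite pi_act // (arcseq_all np pz).
apply/setP=> t; apply/idP/imsetP => [tx | [t' tx ->]]; last exact: sub.
exists (n_act (to^*) t a^-1); first by have := sub _ a^-1 _ tx; rewrite actK.
exact: esym (actKV (to^* * l.+1) a t).
Qed.

Definition block_stars l : {set {set l.+1.-tuple {set T}} * {set l.+1.-tuple {set T}}} :=
  [set (block_star l e.1, block_star l e.2) | e in [set e | adj G e.1 e.2]].

Lemma block_starsP l S R : reflect
  (exists x y, [/\ adj G x y, S = block_star l x & R = block_star l y])
  ((S, R) \in block_stars l).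
Proof.
apply: (iffP imsetP) => [[[x y]] | [x [y [xy -> ->]]]].
  by rewrite inE => xy [-> ->]; exists x, y.
by exists (x, y); rewrite ?inE.
Qed.

Lemma block_star_setP l S : reflect
  (exists2 x, x \in vset G & S = block_star l x) (S \in star_set (block_stars l)).
Proof.
apply: (iffP setUP) => [[]/imsetP[[S' R] /block_starsP[x [y [xy -> eR]]] ->] | [x Vx ->]].
- by exists x; rewrite ?(adjL xy).
- by exists y; rewrite ?(adjR xy).
have : 0 < #|nbr_blocks G P x| by rewrite nbr_blocks_card ?r_gt0.
case/card_gt0P=> C /nbr_blocksP[y xy _]; left; apply/imsetP.
by exists (block_star l x, block_star l y) => //; apply/block_starsP; exists x, y.
Qed.

Lemma block_stars_rank_transitive l : s <= l -> l <= 1 \/ 1 < r ->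
  rank_transitive (to^*)%act s (block_stars l).
Proof.
move=> sl lr; have [_ trV _] := tr; have [inV adjP] := presG.
have [x0 [y0 [xy0 _]]] := quot_edge.
split.
- apply: (@transitive_from _ _ _ _ _ (block_star l x0, block_star l y0)).
  + by apply/block_starsP; exists x0, y0.
  + case=> S R /block_starsP[x [y [xy -> ->]]].
    have [a [<- <-]] := adj_move xy0 xy; exists a; first by rewrite inE.
    by rewrite !block_star_act.
  move=> a _; apply/block_starsP; exists (to x0 a), (to y0 a).
  by rewrite adjP !block_star_act.
- apply: (@transitive_from _ _ _ _ _ (block_star l x0)).
  + by apply/block_star_setP; exists x0; rewrite ?(adjL xy0).
  + move=> S /block_star_setP[x Vx ->]; have [a _ ->] := atransP2 trV (adjL xy0) Vx.
    by exists a; rewrite ?inE // block_star_act.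
  move=> a _; apply/block_star_setP; exists (to x0 a).
    by rewrite inV (adjL xy0).
  by rewrite block_star_act.
move=> _ /block_star_setP[x Vx ->].
have nx : arcseq G [:: x] by rewrite arcseq1.
have [p [np sp]] := arcseq_extend nx (leq0n s) short_or_branching.
have /eqP sz : size (map pi (x :: p)) = s.+1 by rewrite /= size_map sp.
have initialE w : size w = s.+1 -> initial (block_star l x) w ->
    exists2 q, arcseq G (x :: q) & map pi (x :: q) = w.
  case: w => // C w _ /(initial_block_star lr)[-> _ [q nq <-]].
  by exists q.
have [_ _ _ trA] := (arc_transitiveP to G s).1 tr.
apply: (@transitive_from _ _ _ _ _ (Tuple sz)).
- rewrite mem_prefixes; apply/(initial_block_star lr).
  by split; [| rewrite size_map sp | exists p].
- move=> u; rewrite mem_prefixes => /(initialE _ (size_tuple u))[q nq qE].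
  have sq : size (x :: q) = s.+1 by rewrite -(size_map pi) qE size_tuple.
  have [a [xa qa]] := trA (x :: p) (x :: q) (congr1 S sp) sq np nq.
  exists a; first by rewrite stabE -block_star_act -xa.
  apply: val_inj; rewrite /= -qE /= {1}xa qa pi_act // -!map_comp; congr (_ :: _).
  apply/eq_in_map=> z pz /=; apply: pi_act.
  by apply: arcseq_all np _; rewrite inE pz orbT.
move=> a; rewrite stabE => /eqP fixS; rewrite mem_prefixes -{1}fixS.
rewrite (initial_act _ _ a (map pi (x :: p))); apply/(initial_block_star lr).
by split; [| rewrite size_map sp | exists p].
Qed.

(** Stars of two vertices are compared through the sequences that lift from them:
unlike l-arcs, these may have any length, so they can be moved one step along an
edge. *)
Definition words_sub n x x' := forall w, size w <= n -> lifts x w -> lifts x' w.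

(** A lift from y that does not return to x becomes, with x put in front, a lift from
x, hence a lift from x' whose first step is y'. A lift that goes to x first is read
from x onwards; its step out of x goes to a block other than that of y, so the
lift from x' does not return to y'. *)
Lemma words_sub_nbr n x x' y y' : pi x = pi x' -> adj G x y -> adj G x' y' ->
  pi y = pi y' -> words_sub n.+1 x x' -> words_sub n y y'.
Proof.
have [_ _ uniq] := pi_immersion => exx xy xy' eyy sub w sw [p np pw].
case: p np pw => [|z p] np pw.
  by exists [::] => //; rewrite arcseq1 (adjR xy').
have yx' : adj G y' x' by rewrite adj_sym.
case: (eqVneq z x) => [zx | zx]; last first.
  apply: (lifts_cons xy'); rewrite -eyy; apply: sub => //.
  exists [:: y, z & p]; last by rewrite -pw.
  by rewrite arcseq3 xy eq_sym zx.
rewrite {z}zx in np pw; rewrite -pw /= in sw.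
have [|q nq qp] := sub (map pi p) (leqW (ltnW sw)).
  by exists p => //; apply: arcseq_tail np.
exists (x' :: q); last by rewrite -pw /= -exx qp.
case: q p nq qp np {pw sw} => [|u q] [|u0 p] //; first by move=> *; rewrite arcseq2.
move=> nq [uu _]; rewrite !arcseq3 nq yx' andbT /= => /and3P[_ yu0 /arcseq_adj xu0].
apply: contraNneq yu0 => y'u; apply/eqP; apply: uniq xy xu0 _.
by rewrite eyy y'u uu.
Qed.

Lemma words_sub_eq l x x' : l <= 1 \/ 1 < r -> x \in vset G ->
  block_star l x = block_star l x' -> pi x = pi x' /\ words_sub l x x'.
Proof.
move=> lr Vx exx; have lx w : size w <= l -> lifts x w -> pi x = pi x' /\ lifts x' w.
  move=> sw lw.
  have /(initial_block_star lr)[] // : initial (block_star l x') (pi x :: w).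
  by rewrite -exx; apply/(initial_block_star lr).
split=> [|w sw lw]; last by case: (lx w sw lw).
by have [|//] := lx [::] (leq0n _); exists [::]; rewrite ?arcseq1.
Qed.

Lemma words_eq_star l x x' : pi x = pi x' -> words_sub l x x' -> words_sub l x' x ->
  block_star l x = block_star l x'.
Proof.
have sub y y' :
    pi y = pi y' -> words_sub l y y' -> block_star l y \subset block_star l y'.
  move=> eyy syy; apply/subsetP=> t /block_starP[p np tE]; apply/block_starP.
  have sp : size (map pi p) <= l.
    by rewrite -ltnS -[_.+1]/(size (map pi (y :: p))) -tE size_tuple.
  have [|q nq qE] := syy _ sp; first by exists p.
  by exists q; rewrite //= qE -eyy.
by move=> e h h'; apply/eqP; rewrite eqEsubset !sub.
Qed.

Definition star_kernel l : {set T * T} :=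
  [set e in setX (vset G) (vset G) | block_star l e.1 == block_star l e.2].

Lemma star_kernelP l x y :
  reflect [/\ x \in vset G, y \in vset G & block_star l x = block_star l y]
          ((x, y) \in star_kernel l).
Proof. by rewrite !inE /= -andbA; apply: (iffP and3P) => -[? ? /eqP]. Qed.

Lemma star_kernel_decr l : 1 < r -> star_kernel l.+1 \subset star_kernel l.
Proof.
move=> r1; apply/subsetP=> -[x y] /star_kernelP[Vx Vy exy]; apply/star_kernelP.
have lr : l.+1 <= 1 \/ 1 < r by right.
have [e1 s1] := words_sub_eq lr Vx exy; have [_ s2] := words_sub_eq lr Vy (esym exy).
split=> //; apply: words_eq_star => // w sw.
  exact: s1 (leqW sw).
exact: s2 (leqW sw).
Qed.

Lemma star_kernel_stable m : 1 < r ->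
  exists2 l, m <= l & star_kernel l \subset star_kernel l.+1.
Proof.
move=> r1; have [n] := ubnP #|star_kernel m|; elim: n m => // n IH m sm.
case: (boolP (star_kernel m \subset star_kernel m.+1)) => [st | nst]; first by exists m.
have [|l ml st] := IH m.+1; last by exists l => //; apply: ltnW.
apply: leq_trans (_ : #|star_kernel m| <= n); last by rewrite -ltnS.
by apply: proper_card; rewrite properE star_kernel_decr.
Qed.

(** For r > 1 the decreasing kernels stabilize beyond s. For r = 1 one has s = 1 and
l = 1 works, as there are no arcs of length 2. *)
Lemma stable_length : exists l, [/\ s <= l, l <= 1 \/ 1 < r &
  forall x x', x \in vset G -> x' \in vset G ->
    block_star l x = block_star l x' -> words_sub l.+1 x x'].
Proof.
case: (ltnP 1 r) => [r1 | r1].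
  have [l sl st] := star_kernel_stable s r1; exists l; split=> //; first by right.
  move=> x x' Vx Vx' exx.
  have : (x, x') \in star_kernel l by apply/star_kernelP.
  case/(subsetP st)/star_kernelP=> _ _ exx1.
  by have [_] := words_sub_eq (or_intror r1) Vx exx1.
have s1 : s = 1%N.
  by case: short_or_branching => [|]; [case: (s) s_gt0 => [|[]] | rewrite ltnNge r1].
exists 1%N; split=> //; [by rewrite s1 | by left |].
move=> x x' Vx Vx' exx w sw lw; case: (leqP (size w) 1) => [sw1 | sw1].
  by have [_] := words_sub_eq (or_introl (leqnn 1)) Vx exx; apply.
case: lw sw1 => -[|y [|z p]] np <- //= _.
move: np; rewrite arcseq3 => /and3P[xy xz /arcseq_adj yz].
have le1 : #|nbr_blocks G P y| <= 1 by rewrite nbr_blocks_card // (adjR xy).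
have yx : adj G y x by rewrite adj_sym.
have [_ _ uniq] := pi_immersion; case/eqP: xz; apply: (uniq _ _ _ yx yz).
by apply: (card_le1_eqP le1); apply/nbr_blocksP; [exists z | exists x].
Qed.

(** An element g that fixes the star of x takes x to a vertex with the same star, and
if it fixes the block of y it takes y to the neighbour there of the new vertex. *)
Lemma block_stars_balanced l x y : 0 < l -> l <= 1 \/ 1 < r ->
  (forall x x', x \in vset G -> x' \in vset G ->
    block_star l x = block_star l x' -> words_sub l.+1 x x') ->
  adj G x y -> balanced (to^*)%act Q r (block_star l x) (block_star l y).
Proof.
move=> l1 lr faith xy; exists (pi x), (pi y).
split; [exact: is_star_block_star (adjL xy) | exact: is_star_block_star (adjR xy) |].
have [inV adjP] := presG.
have sub u w : adj G u w ->
  'N(block_star l u | to^* * l.+1) :&: 'C[pi w | to^*] \subset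
  'N(block_star l w | to^* * l.+1) :&: 'C[pi u | to^*].
  move=> uw; have [Vu Vw] := (adjL uw, adjR uw).
  apply/subsetP=> g; rewrite 2!in_setI !stabE -!block_star_act.
  case/andP=> /eqP fixu /astab1P; rewrite -pi_act // => fixw.
  have Vug : to u g \in vset G by rewrite inV.
  have [eu _] := words_sub_eq lr Vug fixu.
  have uwg : adj G (to u g) (to w g) by rewrite adjP.
  apply/andP; split; last by apply/astab1P; rewrite -pi_act.
  apply/eqP; apply: words_eq_star => //.
    by apply: (words_sub_nbr eu uwg uw fixw); apply: faith.
  by apply: (words_sub_nbr (esym eu) uw uwg (esym fixw)); apply: faith.
by apply/eqP; rewrite eqEsubset !sub // adj_sym.
Qed.

End BlockStars.

(** * The correspondence *)

Theorem theorem2p2 (X : finGroupType) :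
  (forall (U : finType) (Sigma : sgraph U) (toU : {action X &-> U})
          (b l s r : nat)
          (Theta : {set {set l.+1.-tuple U} * {set l.+1.-tuple U}}),
     X_symmetric toU Sigma -> has_valency Sigma b -> 2 <= b ->
     1 <= s <= l -> 1 <= r < b ->
     (forall S R, (S, R) \in Theta -> is_double_star Sigma r S R) ->
     self_paired Theta ->
     rank_transitive toU s Theta ->
     (exists S R, (S, R) \in Theta /\ balanced toU Sigma r S R) ->
     exists (T : finType) (Gamma : sgraph T) (toT : {action X &-> T})
            (P : {set {set T}}) (v k b' : nat),
       [/\ arc_transitive toT Gamma s,
           nontrivial_invariant_partition toT Gamma P,
           parameters Gamma P v k r b' 1,
           graph_iso (quotient_graph Gamma P) Sigma
         & ~ multicover_params v k r b'])
  /\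
  (forall (s : nat) (T : finType) (Gamma : sgraph T) (toT : {action X &-> T})
          (P : {set {set T}}) (v k r b : nat),
     1 <= s ->
     arc_transitive toT Gamma s ->
     nontrivial_invariant_partition toT Gamma P ->
     parameters Gamma P v k r b 1 ->
     ~ multicover_params v k r b ->
     exists (l : nat) (Theta : {set {set l.+1.-tuple {set T}} *
                                    {set l.+1.-tuple {set T}}}),
       [/\ s <= l,
           forall S R, (S, R) \in Theta ->
             is_double_star (quotient_graph Gamma P) r S R,
           self_paired Theta,
           rank_transitive (toT^*)%act s Theta
         & forall S R, (S, R) \in Theta ->
             balanced (toT^*)%act (quotient_graph Gamma P) r S R]).
Proof.
split.
  move=> U Sigma toU b l s r Theta sym valb _ sl rb ds sp rt bal.
  have [_ /imsetP[u0 _ _] _] := sym.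
  have [v [k par]] := fibre_parameters u0 sym valb sl ds sp rt bal.
  exists {set l.+1.-tuple U}, (star_graph u0 ds sp), (star_act toU l).
  exists (fibres Theta u0), v, k, b; split=> //.
  - exact: star_graph_arc_transitive.
  - exact: (star_graph_partition u0 sym valb sl rb).
  - exact: (quotient_iso u0 sym ds sp rt bal).
  by case=> _ _ rE _; move: rb; rewrite rE ltnn andbF.
move=> s T Gamma toT P v k r b s1 tr inv par _.
have [l [sl lr faith]] := stable_length s1 tr inv par.
have l1 : 0 < l := leq_trans s1 sl.
exists l, (block_stars Gamma P l); split=> //.
- by move=> S R /block_starsP[x [y [xy -> ->]]]; exact: (block_star_double s1 tr inv par).
- move=> S R /block_starsP[x [y [xy -> ->]]]; apply/block_starsP.
  by exists y, x; rewrite adj_sym.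
- exact: (block_stars_rank_transitive s1 tr inv par).
move=> S R /block_starsP[x [y [xy -> ->]]].
exact: (block_stars_balanced s1 tr inv par).
Qed.
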